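(* Let $\mathcal{I}_0=\{i\in\mathcal{I}:\lambda_i<\alpha_i\}$ and $\mathcal{I}_C=\{i\in\mathcal{I}:\lambda_i>\eta_i\}$, and assume $\mathcal{I}=\mathcal{I}_0\cup\mathcal{I}_C$. Then the coupling time $\tau^P$ of the ATO-POS system with individual state-dependent replenishments satisfies $$\mathbb{E}[\tau^P]\le\Lambda\left(\sum_{i\in\mathcal{I}_0}\frac{C_i}{\alpha_i-\lambda_i}+\sum_{i\in\mathcal{I}_C}\frac{C_i}{\lambda_i-\eta_i}\right).$$
   Context: Let $I\ge 1$ be an integer, $\mathcal{I}=\{1,\dots,I\}$, and let $C_1,\dots,C_I$ be positive integers. The state space is $\mathcal{X}=\{0,\dots,C_1\}\times\cdots\times\{0,\dots,C_I\}$. Let $e_i$ be the vector with all components $0$ except the $i$-th, equal to $1$. Rates: for each nonempty $A\subset\mathcal{I}$ let $\lambda_A\ge0$ be the arrival rate of demands for $A$; $\lambda=\sum_A\lambda_A$ and $\lambda_i=\sum_{A\ni i}\lambda_A$. For each $i\in\mathcal{I}$, $\mu_i:\{0,\dots,C_i\}\to[0,\infty)$ with $\mu_i(0)=0$ and $\mu_i(x)>0$ for $x\ge 1$. Put $\beta_i=\max_{1\le x\le C_i}\mu_i(x)$, $\alpha_i=\min_{1\le x\le C_i}\mu_i(x)$, $\eta_i=\max_{1\le x<C_i}\mu_i(x)$ (with $\eta_i=0$ if $C_i=1$), and $\Lambda=\lambda+\sum_{i\in\mathcal{I}}\beta_i$. Let $(\ell_i^{(0)},\dots,\ell_i^{(C_i)})$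 be an ordering of $\{0,\dots,C_i\}$ with $0=\mu_i(\ell_i^{(0)})\le\dots\le\mu_i(\ell_i^{(C_i)})=\beta_i$. Events: $\mathcal{E}=\{d_A:\emptyset\ne A\subset\mathcal{I}\}\cup\{s_i^{(j)}:i\in\mathcal{I},1\le j\le C_i\}$ with probability distribution $\nu(d_A)=\lambda_A/\Lambda$, $\nu(s_i^{(j)})=[\mu_i(\ell_i^{(j)})-\mu_i(\ell_i^{(j-1)})]/\Lambda$. The transition function $f_P:\mathcal{X}\times\mathcal{E}\to\mathcal{X}$ is $$f_P(x,d_A)=x+\sum_{k\in A}\mathbf{1}_{\{x_k<C_k\}}e_k,\qquad f_P(x,s_i^{(j)})=x-\sum_{k=j}^{C_i}\mathbf{1}_{\{x_i=\ell_i^{(k)}\}}e_i .$$ It is extended to words of events by applying the events successively from left to right (the empty word acts as the identity), and to subsets $U\subset\mathcal{X}$ by $f_P(U,w)=\{f_P(x,w):x\in U\}$. Let $(a_{-t})_{t\in\mathbb{N}}=(a_0,a_{-1},a_{-2},\dots)$ be i.i.d. events with distribution $\nu$, and $a_{-t+1\to0}=a_{-t+1}a_{-t+2}\cdots a_0$. The coupling time is $\tau^P=\min\{t: |f_P(\mathcal{X},a_{-t+1\to0})|=1\}$. *)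

(* Defs.v *)
From mathcomp Require Import all_boot all_order all_algebra all_fingroup.
From mathcomp Require Import all_classical all_reals all_analysis.

Set Implicit Arguments.
Unset Strict Implicit.
Unset Printing Implicit Defensive.

Import Order.TTheory GRing.Theory Num.Theory.
Local Open Scope ring_scope.

Definition demand (n : nat) := {A : {set 'I_n} | A != finset.set0}.

Section Model.
Context {R : realType} {n : nat}.

Definition state (C : 'I_n -> nat) := {dffun forall i : 'I_n, 'I_(C i).+1}.

(* [inl A] is the arrival d_A.  [inr s], where [tag s = i] and
   [tagged s = j : 'I_(C i)], is the service s_i^(j+1): service indices range
   over 1, ..., C_i and are stored minus one. *)
Definition event (C : 'I_n -> nat) := (demand n + {i : 'I_n & 'I_(C i)})%type.

Context {C : 'I_n -> nat}.

Section Rates.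
Variables (lam : demand n -> R) (mu : forall i, 'I_(C i).+1 -> R).

Definition total_arrival_rate : R := \sum_(A : demand n) lam A.

Definition arrival_rate (i : 'I_n) : R := \sum_(A : demand n | i \in val A) lam A.

(* The rates are nonnegative, so the default value 0 of these two maxima
   matters only for an empty range: [eta i = 0] when [C i = 1]. *)
Definition beta (i : 'I_n) : R :=
  \big[Num.max/0]_(x : 'I_(C i).+1 | (1 <= x)%N) mu x.

Definition eta (i : 'I_n) : R :=
  \big[Num.max/0]_(x : 'I_(C i).+1 | (1 <= x < C i)%N) mu x.

(* For [0 < C i], the default value [mu ord_max] is itself in the range of the
   minimum. *)
Definition alpha (i : 'I_n) : R :=
  \big[Num.min/mu (@ord_max (C i))]_(x : 'I_(C i).+1 | (1 <= x)%N) mu x.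

Definition total_rate : R := total_arrival_rate + \sum_i beta i.

Variable ell : forall i, {perm 'I_(C i).+1}.

Definition is_rate_ordering : Prop := forall i,
  [/\ mu (ell i ord0) = 0,
      (forall j k : 'I_(C i).+1, (j <= k)%N -> mu (ell i j) <= mu (ell i k)) &
      mu (ell i ord_max) = beta i].

Definition event_prob (e : event C) : R :=
  match e with
  | inl A => lam A / total_rate
  | inr s => let i := tag s in let j := tagged s in
      (mu (ell i (lift ord0 j)) - mu (ell i (widen_ord (leqnSn (C i)) j)))
        / total_rate
  end.

(* The [inord] casts are harmless: the values are at most [C k]. *)
Definition fP (x : state C) (e : event C) : state C :=
  match e with
  | inl A => [ffun k => inord (x k + ((k \in val A) && (x k < C k))%N)%N]
  | inr s => [ffun k => inord (x k - (k == tag s) *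
      \sum_(l < (C k).+1 | ((tagged s).+1 <= l)%N) (x k == ell k l))%N]
  end.

Definition fP_word (x : state C) (w : seq (event C)) : state C := foldl fP x w.

Definition fP_set (U : {set state C}) (w : seq (event C)) : {set state C} :=
  [set fP_word x w | x in U]%SET.

Definition lightly_loaded : {set 'I_n} :=
  [set i | arrival_rate i < alpha i]%SET.

Definition heavily_loaded : {set 'I_n} :=
  [set i | eta i < arrival_rate i]%SET.

End Rates.
End Model.

(* [past a w t] is the word a_{-t+1} ... a_0, where [a t] stands for a_{-t}. *)
Definition past (T E : Type) (a : nat -> T -> E) (w : T) (t : nat) : seq E :=
  rev (mkseq (a^~ w) t).

Section Probability.
Context {R : realType} {d : measure_display} {T : measurableType d}.

(* [E] is finite and carries the discrete sigma-algebra, so that every subset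
   of [E] is measurable. *)
Definition iid (P : probability T R) (E : finType) (nu : E -> R)
    (a : nat -> T -> E) : Prop :=
  [/\ (forall t (B : set E), measurable (a t @^-1` B)%classic),
      (forall t e, P (a t @^-1` [set e])%classic = (nu e)%:E) &
      (forall (J : seq nat) (B : nat -> set E), uniq J ->
        P (\bigcap_(t in [set` J]) (a t @^-1` B t))%classic =
        (\prod_(t <- J) P (a t @^-1` B t)%classic)%E)].

Context {n : nat} {C : 'I_n -> nat}.

Definition coupled (ell : forall i, {perm 'I_(C i).+1})
    (a : nat -> T -> event C) (w : T) (t : nat) : bool :=
  #|fP_set ell [set: state C]%SET (past a w t)| == 1%N.

Definition coupling_time (ell : forall i, {perm 'I_(C i).+1})
    (a : nat -> T -> event C) (w : T) : \bar R :=
  match pselect (exists t, coupled ell a w t) with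
  | left ex => (ex_minn ex)%:R%:E
  | right _ => +oo%E
  end.

End Probability.

(* Main.v *)
Require Import Defs.
From mathcomp Require Import all_boot all_order all_algebra all_fingroup.
From mathcomp Require Import all_classical all_reals all_analysis.
From mathcomp Require Import measurable_realfun zify ring lra.

Set Implicit Arguments.
Unset Strict Implicit.
Unset Printing Implicit Defensive.

Import Order.TTheory GRing.Theory Num.Theory.
Local Open Scope ring_scope.

(* The past word a_{-t+1} ... a_0 has the law of a forward word of length t, and
   it stays coupling when letters are added on its left, so E[tau] is the sum over
   t of the probabilities that a random word of length t is not coupling.  Each
   coordinate evolves autonomously and monotonically, with drift
   (lambda_i 1_{x_i < C_i} - mu_i(x_i)) / Lambda.  If lambda_i < alpha_i, the copy
   started at C_i has drift at most -(alpha_i - lambda_i) / Lambda until it hits 0,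
   where every copy has been absorbed; if lambda_i > eta_i, the copy started at 0
   likewise drifts up to C_i.  A Foster-Lyapunov bound on these hitting times and
   a union bound over i conclude. *)

(** * Random words and hitting times *)

Section WordMean.
Variables (R : realType) (E : finType) (nu : E -> R).

(** The expectation of [g] over [t] independent letters of law [nu], as a finite recursion that
    conditions on the first letter. *)
Fixpoint word_mean t (g : seq E -> R) : R :=
  if t is t'.+1 then \sum_e nu e * word_mean t' (fun w => g (e :: w))
  else g [::].

Lemma eq_word_mean t g h : g =1 h -> word_mean t g = word_mean t h.
Proof.
elim: t g h => [|t IH] g h gh /=; first exact: gh.
by apply: eq_bigr => e _; congr (_ * _); apply: IH => w; exact: gh.
Qed.

Lemma word_mean0 t : word_mean t (fun=> 0) = 0.
Proof. by elim: t => //= t IH; rewrite big1// => e _; rewrite IH mulr0. Qed.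

Lemma word_mean_sum (I : finType) t (g : I -> seq E -> R) :
  word_mean t (fun w => \sum_i g i w) = \sum_i word_mean t (g i).
Proof.
elim: t g => //= t IH g; rewrite exchange_big; apply: eq_bigr => e _.
by rewrite IH mulr_sumr.
Qed.

Hypothesis nu_ge0 : forall e, 0 <= nu e.

Lemma le_word_mean t g h :
  (forall w, g w <= h w) -> word_mean t g <= word_mean t h.
Proof.
elim: t g h => [|t IH] g h gh /=; first exact: gh.
by apply: ler_sum => e _; apply: ler_wpM2l => //; apply: IH => w; exact: gh.
Qed.

Variables (X : Type) (f : X -> E -> X) (Z : pred X).

(** Both the initial and the final state are tested, so on words of length [t] this is the event
    that the hitting time of [Z] exceeds [t]. *)
Fixpoint avoids x w :=
  ~~ Z x && (if w is e :: w' then avoids (f x e) w' else true).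

(* Foster-Lyapunov: the left-hand side is the mean of [minn N t], where [t] is
   the hitting time of [Z] from [x]. *)
Lemma sum_avoids_le (h : X -> R) (c : R) N x :
  \sum_e nu e = 1 -> 0 < c -> (forall y, 0 <= h y) ->
  (forall y, ~~ Z y -> \sum_e nu e * h (f y e) <= h y - c) ->
  \sum_(t < N) word_mean t (fun w => (avoids x w)%:R) <= h x / c.
Proof.
move=> nu1 c0 h0 drift; elim: N x => [|N IH] x.
  by rewrite big_ord0 divr_ge0// ltW.
have [Zx|nZx] := boolP (Z x).
  rewrite big1 ?divr_ge0// ?(ltW c0)// => t _.
  by rewrite -[RHS](word_mean0 t); apply: eq_word_mean => -[|e w] /=; rewrite Zx.
(* The empty word contributes [1], which the decrease [c] of [h] pays for; the other words are
   conditioned on their first letter, leaving the induction hypothesis at [f x e]. *)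
rewrite big_ord_recl /= nZx.
rewrite exchange_big /=.
apply: (@le_trans _ _ (1 + \sum_e nu e * (h (f x e) / c))).
  rewrite lerD2l; apply: ler_sum => e _.
  by rewrite -mulr_sumr; apply: ler_wpM2l.
under eq_bigr do rewrite mulrA.
rewrite -mulr_suml ler_pdivlMr// mulrDl mul1r divfK ?lt0r_neq0//.
by have := drift x nZx; lra.
Qed.

(* [le] sandwiches every trajectory against the one from [x], so that all of them
   agree on [q] once the latter meets the extremal set [Z]. *)
Lemma avoidsN_coalesce (Q : Type) (q : X -> Q) (le : X -> X -> Prop) x y z w :
  (forall y x e, le y x -> le (f y e) (f x e)) ->
  (forall y z e, q y = q z -> q (f y e) = q (f z e)) ->
  (forall x y z, Z x -> le y x -> le z x -> q y = q z) ->
  ~~ avoids x w -> le y x -> le z x -> q (foldl f y w) = q (foldl f z w).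
Proof.
move=> fle fq Zq; elim: w x y z => [|e w IH] x y z /=.
  by rewrite andbT negbK => Zx yx zx; exact: Zq Zx yx zx.
have [Zx|nZx] /= := boolP (Z x); last by move=> av yx zx; apply: IH av _ _; exact: fle.
(* From this visit to [Z] on, the order is no longer used: equality of [q] propagates by itself. *)
move=> _ yx zx; have := fq _ _ e (Zq _ _ _ Zx yx zx).
move: (f y e) (f z e) => {IH yx zx} {}y {}z.
by elim: w y z => //= e' w IH y z yz; apply: IH; exact: fq.
Qed.

End WordMean.

(** * The law of the past of an i.i.d. sequence *)

Section Measure.
Context {R : realType} {d : measure_display} {T : measurableType d}.
Variables (P : probability T R) (E : finType) (nu : E -> R) (a : nat -> T -> E).
Hypothesis a_iid : iid P nu a.

Lemma pastS t w : past a w t.+1 = a t w :: past a w t.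
Proof. by rewrite /past /mkseq -addn1 iotaD map_cat rev_cat. Qed.

Let window t m w := mkseq (fun s => a (t + s)%N w) m.

Let windowS t m w : window t m.+1 w = a t w :: window t.+1 m w.
Proof.
rewrite /window /mkseq /= addn0; congr (_ :: _).
by rewrite (iotaDl 1 0) -map_comp; apply: eq_map => s /=; rewrite addnA addn1.
Qed.

Let prob_window v :
  measurable [set w | window 0 (size v) w == v]%classic /\
  P [set w | window 0 (size v) w == v]%classic = (\prod_(e <- v) nu e)%:E.
Proof.
have [am a_nu a_ind] := a_iid.
case: v => [|e0 v'].
  rewrite (_ : [set _ | _]%classic = setT); last by apply/seteqP; split.
  by rewrite probability_setT big_nil; split.
(* The letter [e0] is kept only as the default value of [nth]. *)
move: (e0 :: v') => {v'} v.
have -> : [set w | window 0 (size v) w == v]%classic =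
    (\bigcap_(s in [set` iota 0 (size v)]) a s @^-1` [set nth e0 v s])%classic.
  apply/seteqP; split => [w /= /eqP wv s|w /= wv].
    by rewrite /= mem_iota add0n => /andP[_ sv]; rewrite -wv nth_mkseq.
  apply/eqP/(@eq_from_nth _ e0); rewrite size_mkseq// => s sv.
  by rewrite nth_mkseq//; apply: wv; rewrite /= mem_iota add0n.
split; first by apply: fin_bigcap_measurable => // s _; exact: am.
rewrite a_ind ?iota_uniq// [in RHS](big_nth e0) /index_iota subn0.
rewrite (big_morph EFin (@EFinM R) erefl).
by apply: eq_bigr => s _; rewrite a_nu.
Qed.

(* The events at times t, ..., t + size v - 1 are prescribed so that the induction
   on t can condition on the event at time t. *)
Lemma prob_past_window t (Q : pred (seq E)) v :
  measurable [set w | Q (past a w t) && (window t (size v) w == v)]%classic /\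
  P [set w | Q (past a w t) && (window t (size v) w == v)]%classic =
  (word_mean nu t (fun w => (Q w)%:R) * \prod_(e <- v) nu e)%:E.
Proof.
have [am a_nu a_ind] := a_iid.
elim: t Q v => [|t IH] Q v.
  have [mB PB] := prob_window v.
  case: (boolP (Q [::])) => [q|/negbTE q] /=.
    by rewrite q mul1r.
  rewrite (_ : [set _ | _]%classic = set0); last by apply/seteqP; split => w //=; rewrite q.
  by rewrite q mul0r measure0.
(* Partition by the letter at time [t]: it is the leftmost letter of the longer past, and it becomes
   the head of the longer window. *)
have part : [set w | Q (past a w t.+1) && (window t.+1 (size v) w == v)]%classic =
    (\bigcup_(e in [set: E]) [set w | Q (e :: past a w t) &&
      (window t (size (e :: v)) w == e :: v)])%classic.
  apply/seteqP; split => [w /=|w [e _ /=]].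
    by rewrite pastS => Qw; exists (a t w) => //=; rewrite windowS eqseq_cons eqxx.
  by rewrite pastS windowS eqseq_cons andbCA => /andP[/eqP <-].
have IHe e := IH (fun w => Q (e :: w)) (e :: v).
rewrite part; split.
  by apply: fin_bigcup_measurable => // e _; exact: (IHe e).1.
rewrite measure_fin_bigcup//; first last.
- by move=> e _; exact: (IHe e).1.
- apply/trivIsetP => e e' _ _ ee'; apply/seteqP; split => // w [/=].
  rewrite !windowS !eqseq_cons => /and3P[_ /eqP ae _] /and3P[_ /eqP ae' _].
  by rewrite -ae ae' eqxx in ee'.
  exact: finite_finset.
rewrite (fsbigE (index_enum E)) ?index_enum_uniq//; last by move=> e _; rewrite mem_index_enum.
under eq_bigl do rewrite in_setT.
rewrite (eq_bigr _ (fun e _ => (IHe e).2)).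
under eq_bigr do rewrite big_cons.
rewrite sumEFin mulr_suml; congr (_%:E); apply: eq_bigr => e _.
by rewrite /= mulrCA mulrA.
Qed.

Lemma prob_past t (Q : pred (seq E)) :
  measurable [set w | Q (past a w t)]%classic /\
  P [set w | Q (past a w t)]%classic = (word_mean nu t (fun w => (Q w)%:R))%:E.
Proof.
have := prob_past_window t Q [::].
rewrite big_nil mulr1 (_ : [set w | _]%classic = [set w | Q (past a w t)]%classic)//.
by apply/seteqP; split => w /=; rewrite andbT.
Qed.

Lemma iid_prob_ge0 e : 0 <= nu e.
Proof. by have [_ a_nu _] := a_iid; rewrite -lee_fin -(a_nu 0). Qed.

(** The total mass is read off the sure event on words of length one. *)
Lemma iid_prob_sum : \sum_e nu e = 1.
Proof.
have [_ /esym] := prob_past 1 (fun=> true).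
rewrite /= (_ : [set w | _]%classic = setT) ?probability_setT; last by apply/seteqP; split.
by under eq_bigr do rewrite mulr1; move=> [].
Qed.


End Measure.

(** * Dynamics and drift of one coordinate *)

Section Queue.
Context {R : realType} {n : nat} {C : 'I_n -> nat}.
Variables (lam : demand n -> R) (mu : forall i, 'I_(C i).+1 -> R).
Variable ell : forall i, {perm 'I_(C i).+1}.

Lemma fP_arrivalE (x : state C) A i :
  fP ell x (inl A) i = (x i + ((i \in val A) && (x i < C i)%N))%N :> nat.
Proof.
rewrite /fP ffunE inordK// ltnS.
by case: ltnP => xC; rewrite ?andbF ?andbT ?addn0 -1?ltnS//; case: (i \in _); lia.
Qed.

(** Since [ell i] is a permutation, the sum in [fP] has at most one nonzero term, at the rank of
    [x i]. A service succeeds when this rank reaches its index; the inequality is strict because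
    indices are stored minus one. *)
Lemma fP_serviceE (x : state C) (s : {i : 'I_n & 'I_(C i)}) i :
  fP ell x (inr s) i =
  (x i - ((i == tag s) && (tagged s < ((ell i)^-1)%g (x i))))%N :> nat.
Proof.
rewrite /fP ffunE inordK; last by rewrite ltnS (leq_trans (leq_subr _ _))// -ltnS.
congr (_ - _)%N; rewrite -mulnb; congr (_ * _)%N.
rewrite big_mkcond (bigD1 (((ell i)^-1)%g (x i)))//= permKV eqxx big1 ?addn0.
  by case: ifP.
move=> l lx; case: ifP => // _; case: eqP => // xl.
by rewrite xl permK eqxx in lx.
Qed.

(** Equal coordinates move together. Distinct ones cannot cross, as an event moves all copies in the
    same direction and by at most one. *)
Lemma fP_coord_mono (x y : state C) e i :
  (x i <= y i)%N -> (fP ell x e i <= fP ell y e i)%N.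
Proof.
rewrite leq_eqVlt => /predU1P[xy|].
  by case: e => [A|s]; rewrite ?fP_arrivalE ?fP_serviceE (val_inj xy).
have := ltn_ord (y i).
case: e => [A|s]; rewrite ?fP_arrivalE ?fP_serviceE; lia.
Qed.

Lemma fP_coord_eq (x y : state C) e i :
  x i = y i -> fP ell x e i = fP ell y e i.
Proof. by move=> xy; apply/val_inj/eqP; rewrite eqn_leq !fP_coord_mono ?xy. Qed.

Hypothesis mu0 : forall i, mu (@ord0 (C i)) = 0.
Hypothesis mu_gt0 : forall i (x : 'I_(C i).+1), (1 <= x)%N -> 0 < mu x.
Hypothesis ell_ordering : is_rate_ordering mu ell.

Lemma rate_ordering0 i : ell i ord0 = ord0.
Proof.
have [ell0 _ _] := ell_ordering i; apply: val_inj => /=.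
by have [//|/(mu_gt0 (x := ell i ord0))] := posnP (ell i ord0); rewrite ell0 ltxx.
Qed.

(** The increments telescope: the services that succeed at rank [r] have total rate equal to the
    service rate of that state. *)
Lemma sum_service_rates_below i (r : 'I_(C i).+1) :
  \sum_(j < C i | (j < r)%N) (mu (ell i (lift ord0 j)) -
     mu (ell i (widen_ord (leqnSn (C i)) j))) = mu (ell i r).
Proof.
pose m k := mu (ell i (inord k)).
transitivity (\sum_(j < C i | (j < r)%N) (m j.+1 - m j)).
  apply: eq_bigr => j _; rewrite /m; congr (mu (ell i _) - mu (ell i _)); apply: val_inj => /=.
    by rewrite inordK // ltnS ltn_ord.
  by rewrite inordK// ltnS ltnW.
rewrite -(big_ord_widen _ (fun j => m j.+1 - m j)) -1?ltnS//.
rewrite -(big_mkord xpredT (fun j => m j.+1 - m j)) telescope_sumr// /m inord_val.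
rewrite (_ : inord 0 = ord0); last by apply: val_inj; rewrite /= inordK.
by rewrite rate_ordering0 mu0 subr0.
Qed.

Let Lam := total_rate lam mu.

Lemma coord_drift (x : state C) i :
  \sum_e event_prob lam mu ell e * ((fP ell x e i)%:R - (x i)%:R) =
  ((x i < C i)%N%:R * arrival_rate lam i - mu (x i)) / Lam.
Proof.
rewrite big_sumType.
have -> : \sum_(A : demand n) event_prob lam mu ell (inl A) *
    ((fP ell x (inl A) i)%:R - (x i)%:R) = (x i < C i)%N%:R * arrival_rate lam i / Lam.
  rewrite /arrival_rate [in RHS]big_mkcond mulr_sumr mulr_suml; apply: eq_bigr => A _ /=.
  rewrite fP_arrivalE natrD -/Lam addrAC subrr add0r.
  by case: (i \in _); case: (x i < C i)%N; rewrite /=; ring.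
rewrite mulrBl; congr (_ + _).
pose F k (j : 'I_(C k)) := event_prob lam mu ell (inr (Tagged _ j)) *
  ((fP ell x (inr (Tagged _ j)) i)%:R - (x i)%:R).
transitivity (\sum_(s : {k : 'I_n & 'I_(C k)}) F (tag s) (tagged s)).
  by apply: eq_bigr => -[k j].
rewrite -(sig_big_dep xpredT (fun _ => xpredT) F) (bigD1 i)//= [X in _ + X]big1; last first.
  move=> k ki; rewrite big1// => j _.
  by rewrite /F fP_serviceE /= eq_sym (negbTE ki) subn0 subrr mulr0.
rewrite addr0 -[in mu (x i)](permKV (ell i) (x i)) -sum_service_rates_below.
rewrite mulr_suml -sumrN [RHS]big_mkcond; apply: eq_bigr => j _ /=.
rewrite /F fP_serviceE /= eqxx /= -/Lam; case: ltnP => jr /=; last first.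
  by rewrite subn0 subrr mulr0.
rewrite natrB ?opprB//; first by ring.
(* The truncated subtraction is exact: state [0] has rank [0], so no service succeeds there. *)
rewrite lt0n; apply: contraTN jr => /eqP x0.
have -> : x i = ord0 by apply: val_inj.
have -> : ((ell i)^-1)%g ord0 = ord0 by apply: (canLR (permK _)); rewrite rate_ordering0.
by [].
Qed.

(** * Coalescence of the coordinates *)

Hypothesis C_gt0 : forall i, (0 < C i)%N.
Hypothesis lam_ge0 : forall A, 0 <= lam A.

Let nu := event_prob lam mu ell.
Hypothesis nu_ge0 : forall e, 0 <= nu e.
Hypothesis nu_sum : \sum_e nu e = 1.

(** The argument supplies a component [i], whose [beta] is at least the positive rate at [C i]. *)
Lemma total_rate_gt0 : 'I_n -> 0 < Lam.
Proof.
move=> i; rewrite /Lam /total_rate ltr_wpDl ?sumr_ge0//.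
have b_ge0 k : 0 <= beta mu k by exact: bigmax_ge_id.
rewrite (bigD1 i)//= ltr_wpDr ?sumr_ge0//.
apply: lt_le_trans (mu_gt0 (x := @ord_max (C i)) _) _; first exact: C_gt0.
by rewrite /beta le_bigmax_cond//= C_gt0.
Qed.

Lemma coord_affine_drift (x : state C) i (h : state C -> R) (u s : R) :
  (forall y, h y = u + s * (y i)%:R) ->
  \sum_e nu e * h (fP ell x e) =
  h x + s * ((x i < C i)%N%:R * arrival_rate lam i - mu (x i)) / Lam.
Proof.
move=> hE; have -> : h x = \sum_e nu e * h x by rewrite -mulr_suml nu_sum mul1r.
rewrite -mulrA -coord_drift mulr_sumr -big_split; apply: eq_bigr => e _ /=.
by rewrite /nu !hE; ring.
Qed.

Definition coalesced_at i (w : seq (event C)) :=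
  [forall x : state C, forall y : state C, fP_word ell x w i == fP_word ell y w i].

(** The Lyapunov function is [x i], along the trajectory from the full state; outside [0] the
    service rate is at least [alpha] and the accepted arrival rate at most [arrival_rate]. *)
Lemma sum_uncoalesced_light_le i N : arrival_rate lam i < alpha mu i ->
  \sum_(t < N) word_mean nu t (fun w => (~~ coalesced_at i w)%:R) <=
  Lam * ((C i)%:R / (alpha mu i - arrival_rate lam i)).
Proof.
move=> light; have Lam_gt0 := total_rate_gt0 i.
pose Z (x : state C) := x i == ord0.
pose h (x : state C) : R := (x i)%:R.
pose top : state C := [ffun k => ord_max].
apply: (@le_trans _ _ (h top / ((alpha mu i - arrival_rate lam i) / Lam))); last first.
  by rewrite /h ffunE /= invf_div mulrCA mulrA.
apply: le_trans (sum_avoids_le (f := fP ell) (Z := Z) nu_ge0 N _ nu_sum _ _ _); last 3 first.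
- by rewrite divr_gt0// subr_gt0.
- by move=> y; rewrite /h.
- move=> y Zy; rewrite (@coord_affine_drift _ i _ 0 1); last by move=> z; rewrite /h; ring.
  rewrite mul1r lerD2l -mulNr opprB ler_pM2r ?invr_gt0//.
  have a_mu : alpha mu i <= mu (y i).
    by apply: bigmin_le_cond; rewrite lt0n; apply: contra Zy => /eqP y0; apply/eqP/val_inj.
  have : (y i < C i)%N%:R * arrival_rate lam i <= arrival_rate lam i.
    by rewrite ler_piMl ?lern1 ?leq_b1// sumr_ge0.
  by lra.
apply: ler_sum => t _; apply: le_word_mean => // w.
rewrite ler_nat; case: (boolP (avoids _ _ _ _)) => [_|av]; first exact: leq_b1.
rewrite leqn0 eqb0 negbK; apply/forallP => x; apply/forallP => y; apply/eqP.
apply: (avoidsN_coalesce (q := fun x : state C => x i)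
  (le := fun y x : state C => (y i <= x i)%N) _ _ _ av).
- by move=> ? ? ?; exact: fP_coord_mono.
- by move=> ? ? ?; exact: fP_coord_eq.
- move=> {}x {}y z /eqP ->; rewrite !leqn0 => /eqP y0 /eqP z0.
  by apply: val_inj; rewrite /= y0 z0.
- by rewrite ffunE -ltnS.
- by rewrite ffunE -ltnS.
Qed.

(** The mirror image: the Lyapunov function is the free room [C i - x i], from the empty state;
    below [C i] every arrival is accepted. *)
Lemma sum_uncoalesced_heavy_le i N : eta mu i < arrival_rate lam i ->
  \sum_(t < N) word_mean nu t (fun w => (~~ coalesced_at i w)%:R) <=
  Lam * ((C i)%:R / (arrival_rate lam i - eta mu i)).
Proof.
move=> heavy; have Lam_gt0 := total_rate_gt0 i.
pose Z (x : state C) := x i == ord_max.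
pose h (x : state C) : R := (C i)%:R - (x i)%:R.
pose bot : state C := [ffun k => ord0].
apply: (@le_trans _ _ (h bot / ((arrival_rate lam i - eta mu i) / Lam))); last first.
  by rewrite /h ffunE /= subr0 invf_div mulrCA mulrA.
apply: le_trans (sum_avoids_le (f := fP ell) (Z := Z) nu_ge0 N _ nu_sum _ _ _); last 3 first.
- by rewrite divr_gt0// subr_gt0.
- by move=> y; rewrite /h subr_ge0 ler_nat -ltnS.
- move=> y Zy; rewrite (@coord_affine_drift _ i _ (C i)%:R (-1)); last by move=> z; rewrite /h; ring.
  have yC : (y i < C i)%N.
    rewrite ltn_neqAle -[X in _ && X]ltnS ltn_ord andbT.
    by apply: contra Zy => /eqP yC; apply/eqP/val_inj.
  rewrite lerD2l -mulNr ler_pM2r ?invr_gt0// yC mul1r.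
  suff : mu (y i) <= eta mu i by lra.
  (* State [0] lies outside the range of the maximum [eta]; there the default value [0] of that
     maximum gives the bound. *)
  have [y0|y_gt0] := posnP (y i); last by apply: le_bigmax_cond; rewrite y_gt0 yC.
  by rewrite (_ : y i = ord0) ?mu0 ?bigmax_ge_id//; exact: val_inj.
apply: ler_sum => t _; apply: le_word_mean => // w.
rewrite ler_nat; case: (boolP (avoids _ _ _ _)) => [_|av]; first exact: leq_b1.
rewrite leqn0 eqb0 negbK; apply/forallP => x; apply/forallP => y; apply/eqP.
apply: (avoidsN_coalesce (q := fun x : state C => x i)
  (le := fun y x : state C => (x i <= y i)%N) _ _ _ av).
- by move=> ? ? ?; exact: fP_coord_mono.
- by move=> ? ? ?; exact: fP_coord_eq.
- move=> {}x {}y z /eqP ->; move: (ltn_ord (y i)) (ltn_ord (z i)) => /=.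
  by rewrite !ltnS => yC zC Cy Cz; apply/val_inj/eqP => /=; lia.
- by rewrite ffunE.
- by rewrite ffunE.
Qed.

Lemma card_fP_set_eq1 w :
  (#|fP_set ell [set: state C]%SET w| == 1%N) = [forall i, coalesced_at i w].
Proof.
apply/idP/forallP => [/cards1P[z zE] i|co].
  apply/forallP => x; apply/forallP => y.
  have im u : fP_word ell u w = z.
    by apply/set1P; rewrite -zE; apply: imset_f; rewrite inE.
  by rewrite !im.
pose x0 : state C := [ffun k => ord0].
apply/cards1P; exists (fP_word ell x0 w); apply/setP => z; rewrite inE.
apply/imsetP/eqP => [[x _ ->]|->]; last by exists x0; rewrite ?inE.
by apply/ffunP => i; apply/eqP; move/forallP/(_ x)/forallP/(_ x0): (co i).
Qed.

(** A letter added on the left only changes the initial states to which [w] is applied. *)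
Lemma coalesced_at_cons i e w : coalesced_at i w -> coalesced_at i (e :: w).
Proof.
move=> co; apply/forallP => x; apply/forallP => y.
by move/forallP/(_ (fP ell x e))/forallP/(_ (fP ell y e)): co.
Qed.

End Queue.

(** * The coupling time and its expectation *)

(** Coupling persists as the past grows, so the terms equal to [1] are exactly those before the
    coupling time. *)
Lemma coupling_time_series (R : realType) (d : measure_display)
    (T : measurableType d) n (C : 'I_n -> nat) (ell : forall i, {perm 'I_(C i).+1})
    (a : nat -> T -> event C) (w : T) :
  coupling_time ell a w =
  (\sum_(0 <= t <oo) ((~~ coupled ell a w t)%:R : R)%:E)%E.
Proof.
have coupledS t : coupled ell a w t -> coupled ell a w t.+1.
  rewrite /coupled !card_fP_set_eq1 pastS => /forallP co.
  by apply/forallP => i; exact: coalesced_at_cons.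
have uncoupled_ge0 t : (0 <= ((~~ coupled ell a w t)%:R : R)%:E)%E by rewrite lee_fin.
rewrite /coupling_time; case: pselect => [ex|nex].
  case: ex_minnP => m cm m_min; rewrite (nneseries_split 0 m)//.
  rewrite [X in _ = (_ + X)%E]eseries0 ?adde0.
    rewrite big_mkord sumEFin (eq_bigr (fun=> 1)) ?sumr_const ?card_ord// => t _.
    by rewrite (contra (m_min t))// -ltnNge.
  move=> t mt _; rewrite (_ : coupled ell a w t)//.
  by rewrite -(subnKC mt) add0n; elim: (t - m)%N => [|k]; rewrite ?addn0// addnS; exact: coupledS.
(* Without coupling all terms are [1], and the first [Num.bound A] of them exceed [A]. *)
apply/esym/eqyP => A A_gt0.
apply: le_trans (nneseries_lim_ge (Num.bound A) (fun t _ _ => uncoupled_ge0 t)).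
rewrite big_mkord sumEFin (eq_bigr (fun=> 1)) ?sumr_const ?card_ord.
  by rewrite lee_fin ltW// archi_boundP// ltW.
by move=> t _; rewrite (_ : ~~ _)//; apply/negP => ct; apply: nex; exists t.
Qed.

Theorem proposition11 (R : realType) (n : nat) (n_gt0 : (0 < n)%N)
  (C : 'I_n -> nat) (C_gt0 : forall i, (0 < C i)%N)
  (lam : demand n -> R) (lam_ge0 : forall A, 0 <= lam A)
  (mu : forall i, 'I_(C i).+1 -> R)
  (mu0 : forall i, mu i ord0 = 0)
  (mu_gt0 : forall i (x : 'I_(C i).+1), (1 <= x)%N -> 0 < mu i x)
  (ell : forall i, {perm 'I_(C i).+1})
  (ell_ordering : is_rate_ordering mu ell)
  (d : measure_display) (T : measurableType d) (P : probability T R)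
  (a : nat -> T -> event C)
  (a_iid : iid P (event_prob lam mu ell) a)
  (loaded : lightly_loaded lam mu :|: heavily_loaded lam mu = [set: 'I_n]%SET) :
  (\int[P]_w coupling_time ell a w <=
    (total_rate lam mu *
      (\sum_(i in lightly_loaded lam mu)
          (C i)%:R / (alpha mu i - arrival_rate lam i) +
       \sum_(i in heavily_loaded lam mu)
          (C i)%:R / (arrival_rate lam i - eta mu i)))%:E)%E.
Proof.
have nu_ge0 := iid_prob_ge0 a_iid; have nu_sum := iid_prob_sum a_iid.
have [uncoupled_meas uncoupled_prob] : (forall t,
    measurable [set w | ~~ coupled ell a w t]%classic) /\ (forall t,
    P [set w | ~~ coupled ell a w t]%classic =
    (word_mean (event_prob lam mu ell) t
      (fun w => (~~ [forall i, coalesced_at ell i w])%:R))%:E).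
  have eq_set t : [set w | ~~ coupled ell a w t]%classic =
      [set w | ~~ [forall i, coalesced_at ell i (past a w t)]]%classic.
    by apply/seteqP; split => w /=; rewrite /coupled card_fP_set_eq1.
  by split=> t; rewrite eq_set; have [] := prob_past a_iid t
    (fun w => ~~ [forall i, coalesced_at ell i w]).
under eq_integral do rewrite coupling_time_series.
have indicE t : (fun w => ((~~ coupled ell a w t)%:R : R)%:E) =
    (fun w => (\1_[set w | ~~ coupled ell a w t]%classic w)%:E).
  by apply/funext => w; rewrite indicE mem_setE.
(* Tonelli: the expectation becomes the series of the probabilities of not having coupled, whose
   partial sums are bounded uniformly below. *)
rewrite integral_nneseries//; last first.
  move=> t; rewrite indicE; apply/measurable_EFinP; exact: measurable_indic.
rewrite (eq_eseriesr (g := fun t => (word_mean (event_prob lam mu ell) t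
    (fun w => (~~ [forall i, coalesced_at ell i w])%:R))%:E)); last first.
  move=> t _; rewrite indicE integral_indic// setIT; exact: uncoupled_prob.
apply: lime_le.
  apply: is_cvg_nneseries => t _ _.
  by rewrite lee_fin -(word_mean0 (event_prob lam mu ell) t); exact: le_word_mean.
near=> N.
rewrite big_mkord sumEFin lee_fin.
pose light i : R := (C i)%:R / (alpha mu i - arrival_rate lam i).
pose heavy i : R := (C i)%:R / (arrival_rate lam i - eta mu i).
pose L := lightly_loaded lam mu; pose H := heavily_loaded lam mu.
pose uncoalesced i w : R := (~~ coalesced_at ell i w)%:R.
(* Union bound over the coordinates that have not coalesced. *)
apply: (@le_trans _ _ (\sum_(t < N) word_mean (event_prob lam mu ell) t
    (fun w => \sum_i uncoalesced i w))).
  apply: ler_sum => t _; apply: le_word_mean => // w.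
  rewrite negb_forall; case: existsP => [[i nco]|_]; last exact: sumr_ge0.
  by rewrite (bigD1 i)//= /uncoalesced nco lerDl sumr_ge0.
under eq_bigr do rewrite word_mean_sum.
rewrite exchange_big (big_mkcond (mem L)) (big_mkcond (mem H)) -big_split mulr_sumr.
apply: ler_sum => i _ /=.
(* When [C i = 1], [i] may lie in both [L] and [H]; one term suffices for the bound and the other is
   nonnegative. *)
have light_ge0 : 0 <= (if i \in L then light i else 0).
  by case: ifP; rewrite // inE => iL; rewrite divr_ge0// subr_ge0 ltW.
have heavy_ge0 : 0 <= (if i \in H then heavy i else 0).
  by case: ifP; rewrite // inE => iH; rewrite divr_ge0// subr_ge0 ltW.
have Lam_ge0 : 0 <= total_rate lam mu by exact/ltW/total_rate_gt0.
have : i \in [set: 'I_n]%SET by rewrite inE.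
rewrite -loaded inE => /orP[iL|iH].
  apply: (@le_trans _ _ (total_rate lam mu * light i)); last first.
    by rewrite ler_wpM2l//; move: heavy_ge0; rewrite -/L iL lerDl.
  by apply: sum_uncoalesced_light_le => //; rewrite inE in iL.
apply: (@le_trans _ _ (total_rate lam mu * heavy i)); last first.
  by rewrite ler_wpM2l//; move: light_ge0; rewrite -/H iH lerDr.
by apply: sum_uncoalesced_heavy_le => //; rewrite inE in iH.
Unshelve. all: by end_near.
Qed.
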